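(* Let $n\ge 2$ and let $G$ be isomorphic to the Hanaki group $A(n,\mathcal V)$, where $\mathcal V$ is the Frobenius automorphism $x\mapsto x^2$ of the field $GF(2^n)$. Then the signless Laplacian spectrum of the non-commuting graph $\Gamma_G$ is $$\left\{(2^{2n}-2^{n+1})^{2^{2n}-2^{n+1}+1},\ (2^{2n}-3\cdot 2^n)^{2^n-2},\ (2^{2n+1}-2^{n+2})^1\right\}$$ and its signless Laplacian energy is $LE^+(\Gamma_G)=2^{2n+1}-2^{n+2}$.
   Context: The group $A(n,\mathcal V)$ consists of the matrices $U(a,b)=\begin{bmatrix}1&0&0\\ a&1&0\\ b&\mathcal V(a)&1\end{bmatrix}$ with $a,b\in GF(2^n)$, under matrix multiplication, so $U(a,b)U(a',b')=U(a+a',\,b+b'+a'\mathcal V(a))$. For a finite non-abelian group $G$ with center $Z(G)$, the non-commuting graph $\Gamma_G$ is the simple undirected graph with vertex set $G\setminus Z(G)$ in which $x,y$ are adjacent iff $xy\ne yx$. For a finite simple graph $\mathcal G$ with vertex set $v(\mathcal G)$, edge set $e(\mathcal G)$, adjacency matrix $A(\mathcal G)$ and diagonal degree matrix $D(\mathcal G)$, the signless Laplacian matrix is $Q(\mathcal G)=D(\mathcal G)+A(\mathcal G)$, and its signless Laplacian spectrum is the multiset of eigenvalues of $Q(\mathcal G)$. The notation $\{(\gamma_1)^{d_1},\dots,(\gamma_l)^{d_l}\}$ means the multiset in which $\gamma_r$ is listed $d_r$ times. The signless Laplacian energy is $LE^+(\mathcal G)=\sum_{\gamma}\left|\gamma-\frac{2|e(\mathcal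 G)|}{|v(\mathcal G)|}\right|$, the sum being over the signless Laplacian spectrum with multiplicity. *)

(* Defs.v *)
From HB Require Import structures.
From mathcomp Require Import all_boot all_order all_algebra.
From mathcomp Require Import all_fingroup all_solvable all_field.

Set Implicit Arguments.
Unset Strict Implicit.
Unset Printing Implicit Defensive.

Import Order.TTheory GRing.Theory Num.Theory GroupScope.
Local Open Scope ring_scope.

Section HanakiGroup.

Variables (F : finFieldType) (V : {rmorphism F -> F}).

(* The automorphism is a ring endomorphism of F: injective as F is a field,
   hence bijective as F is finite. *)
Definition hanaki_mx (a b : F) : 'M[F]_3 :=
  \matrix_(i < 3, j < 3)
    (nth [::] [:: [:: 1; 0;   0];
                  [:: a; 1;   0];
                  [:: b; V a; 1]] i)`_j.

Lemma hanaki_mxM a b a' b' :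
  hanaki_mx a b *m hanaki_mx a' b' =
    hanaki_mx (a + a') (b + b' + a' * V a).
Proof.
apply/matrixP => -[[|[|[|i]]] hi] [[|[|[|j]]] hj] //;
  rewrite !mxE !big_ord_recl big_ord0 !mxE /= ?(mulr0, mul0r, mulr1, mul1r)
    ?(addr0, add0r) ?rmorphD //.
by rewrite -addrA [b' + _]addrC [V a * a']mulrC.
Qed.

Lemma hanaki_mx00 : hanaki_mx 0 0 = 1%:M.
Proof.
apply/matrixP => -[[|[|[|i]]] hi] [[|[|[|j]]] hj] //;
  by rewrite !mxE //= rmorph0.
Qed.

Lemma hanaki_mx_unit a b : hanaki_mx a b \is a GRing.unit.
Proof.
have /mulmx1_unit[//] :
  hanaki_mx a b *m hanaki_mx (- a) (- b + a * V a) = 1%:M.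
by rewrite hanaki_mxM subrr addrA subrr add0r mulNr subrr hanaki_mx00.
Qed.

Definition hanaki_elt (a b : F) : {'GL_3[F]} :=
  Sub (hanaki_mx a b) (hanaki_mx_unit a b).

Definition hanaki : {set {'GL_3[F]}} :=
  [set hanaki_elt p.1 p.2 | p in [set: F * F]].

Lemma hanaki_eltM a b a' b' :
  (hanaki_elt a b * hanaki_elt a' b')%g =
    hanaki_elt (a + a') (b + b' + a' * V a).
Proof. by apply: val_inj; apply: hanaki_mxM. Qed.

Lemma hanaki_group_set : group_set hanaki.
Proof.
apply/group_setP; split.
  apply/imsetP; exists (0, 0) => //; apply: val_inj => /=.
  by rewrite hanaki_mx00.
move=> _ _ /imsetP[[a b] _ ->] /imsetP[[a' b'] _ ->].
by rewrite hanaki_eltM /=; apply/imsetP; exists (a + a', b + b' + a' * V a).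
Qed.

Canonical hanaki_group := Group hanaki_group_set.

End HanakiGroup.

Record sgraph := SGraph {
  vertex :> finType;
  adj : rel vertex;
  adj_sym : symmetric adj;
  adj_irrefl : irreflexive adj
}.

Section SignlessLaplacian.

Variables (C : numClosedFieldType) (g : sgraph).

Definition edges : {set {set g}} :=
  [set [set p.1; p.2] | p in [set p : g * g | adj p.1 p.2]].

Definition degree (x : g) : nat := #|[set y : g | adj x y]|.

Definition adjacency_mx : 'M[C]_#|g| :=
  \matrix_(i, j) (adj (enum_val i : g) (enum_val j))%:R.

Definition degree_mx : 'M[C]_#|g| :=
  diag_mx (\row_i (degree (enum_val i))%:R).

Definition signless_laplacian : 'M[C]_#|g| := degree_mx + adjacency_mx.

End SignlessLaplacian.

Section Spectrum.

Variable C : numClosedFieldType.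

(* The roots of the characteristic polynomial listed with multiplicity, in an
   arbitrary order: to be compared up to perm_eq. *)
Definition spectrum m (M : 'M[C]_m) : seq C :=
  sval (closed_field_poly_normal (char_poly M)).

Lemma spectrumP m (M : 'M[C]_m) :
  char_poly M = \prod_(z <- spectrum M) ('X - z%:P).
Proof.
rewrite /spectrum; case: closed_field_poly_normal => s /= {1}->.
by rewrite (monicP (char_poly_monic M)) scale1r.
Qed.

Definition signless_spectrum (g : sgraph) : seq C :=
  spectrum (signless_laplacian C g).

Definition signless_energy (g : sgraph) : C :=
  \sum_(z <- signless_spectrum g)
    `|z - (2 * #|edges g|)%:R / #|g|%:R|.

End Spectrum.

Section NonCommutingGraph.

Variables (gT : finGroupType) (G : {group gT}).

Definition noncentral := {x : gT | x \in G :\: 'Z(G)}.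

Definition noncommuting : rel noncentral :=
  fun x y => (val x * val y != val y * val x)%g.

Lemma noncommuting_sym : symmetric noncommuting.
Proof. by move=> x y; rewrite /noncommuting eq_sym. Qed.

Lemma noncommuting_irrefl : irreflexive noncommuting.
Proof. by move=> x; rewrite /noncommuting eqxx. Qed.

Definition noncommuting_graph : sgraph :=
  SGraph noncommuting_sym noncommuting_irrefl.

End NonCommutingGraph.

(* Main.v *)
(* With q = 2^n, U(a,b) and U(a',b') commute iff a = 0, a' = 0 or a = a': they
   commute iff a'a^2 = aa'^2. So a noncentral element is one with a != 0, and
   the non-commuting graph is the complete (q - 1)-partite graph whose parts are
   the fibres of U(a,b) |-> a, all of size q. Its signless Laplacian is d - UW,
   where d = q(q - 2) is the degree, U is the vertex-part incidence matrix and W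
   is the transpose of U with every entry decreased by 1; Sylvester's
   determinant identity reduces its characteristic polynomial to that of WU, and
   a second time to a 1 x 1 determinant. *)
Require Import Defs.
From mathcomp Require Import all_boot all_order all_algebra.
From mathcomp Require Import all_fingroup all_solvable all_field.
From mathcomp Require Import ring zify.
Import GRing.Theory Num.Theory GroupScope.
Local Open Scope ring_scope.

(** * Determinants and the characteristic polynomial of a multipartite matrix *)

Lemma det_scalar_addmulC (R : comNzRingType) (m n : nat) (a : R)
    (A : 'M_(m, n)) (B : 'M_(n, m)) :
  a ^+ n * \det (a%:M + A *m B) = a ^+ m * \det (a%:M + B *m A).
Proof.
(* Multiplying M on the right, resp. on the left, by a block lower triangular
   matrix clears one of its off-diagonal blocks. *)
pose M := block_mx a%:M (- A) B 1%:M.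
have detM : \det M = \det (a%:M + A *m B).
  rewrite -[LHS]mulr1 -[X in _ * X](_ : \det (block_mx 1%:M 0 (- B) 1%:M) = 1).
    rewrite -det_mulmx mulmx_block !mulmx1 !mulmx0 mul1mx mulmxN mulNmx opprK.
    by rewrite subrr !add0r det_ublock det1 mulr1.
  by rewrite det_lblock !det1 mulr1.
rewrite -detM -(det_scalar n a) -(det_scalar m a) -[LHS]mul1r -(det1 R m).
rewrite mulrA -(det_lblock 1%:M (- B)) -det_mulmx mulmx_block !mul1mx !mul0mx.
rewrite !addr0 !mulmx1 !mulNmx mulmxN opprK scalar_mxC addNr.
by rewrite det_ublock [B *m A + _]addrC.
Qed.

Lemma sum_indicator_mul (R : nzRingType) (I : finType) (i : I) (F : I -> R) :
  \sum_k (i == k)%:R * F k = F i.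
Proof.
rewrite (bigD1 i) //= eqxx mul1r big1 ?addr0 // => k.
by rewrite eq_sym => /negPf->; rewrite mul0r.
Qed.

Lemma card_uniform_fibers (I J : finType) (h : I -> J) (q : nat) :
  (forall k, #|[set i | h i == k]| = q) -> #|I| = (#|J| * q)%N.
Proof.
move=> hq; rewrite -sum1_card (partition_big h predT) //=.
rewrite (eq_bigr (fun=> q)) ?sum_nat_const // => k _.
by rewrite sum1_card -(hq k) cardsE.
Qed.

(** In characteristic 0 the factors come, in order, from vectors with sum zero on every part, from
    vectors constant on parts with total sum zero, and from constant vectors. *)
Lemma char_poly_multipartite (R : idomainType) (N r q : nat)
    (h : 'I_N -> 'I_r.+1) (d : R) :
    (forall k, #|[set i | h i == k]| = q.+1) ->
  char_poly (\matrix_(i, j) (d *+ (i == j) + (h i != h j)%:R)) =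
    ('X - d%:P) ^+ (r.+1 * q) * ('X - (d - q.+1%:R)%:P) ^+ r
      * ('X - (d + (r * q.+1)%:R)%:P).
Proof.
move=> hq; set M := \matrix_(i, j) _.
have defN : N = (r.+1 * q + r.+1)%N.
  by have := card_uniform_fibers _ _ _ _ hq; rewrite !card_ord mulnS addnC.
pose a := 'X - d%:P; pose b := 'X - (d - q.+1%:R)%:P.
pose U : 'M[{poly R}]_(N, r.+1) := \matrix_(i, k) (h i == k)%:R.
pose W : 'M[{poly R}]_(r.+1, N) := \matrix_(k, j) ((h j == k)%:R - 1).
have -> : char_poly M = \det (a%:M + U *m W).
  congr (\det _); apply/matrixP => i j; rewrite !mxE.
  under [X in _ = _ + X]eq_bigr do rewrite !mxE.
  rewrite sum_indicator_mul polyCD rmorphMn rmorph_nat /= opprD addrA -mulrnBl.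
  congr (_ + _); rewrite eq_sym.
  by case: eqP => _; rewrite ?subrr ?sub0r ?oppr0.
(* Each fibre has [q.+1] elements, so [W *m U] is [q.+1] times the identity minus the all-ones
   matrix. Since [b = a + q.+1], a rank-one perturbation of [b%:M] remains. *)
have WU : a%:M + W *m U
    = b%:M + const_mx (- q.+1%:R) *m (const_mx 1 : 'rV_r.+1).
  apply/matrixP => k l; rewrite !mxE big_ord1 !mxE mulr1.
  have -> : \sum_j W k j * U j l = ((l == k)%:R - 1) * q.+1%:R.
    rewrite -(hq l) -sum1_card natr_sum mulr_sumr [RHS]big_mkcond /=.
    apply: eq_bigr => j _; rewrite !mxE inE.
    by case: (eqVneq (h j) l) => [->|]; rewrite ?mulr1 ?mulr0.
  rewrite [l == k]eq_sym /b /a; case: eqP => _ /=; rewrite ?mulr1n ?mulr0n.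
    by rewrite polyCB polyC_natr; ring.
  by ring.
have b0 : b != 0 by rewrite polyXsubC_eq0.
have a0 : a != 0 by rewrite polyXsubC_eq0.
(* The powers of [a] and [b] required by the determinant identity are inserted on both sides; they
   are nonzero in a domain, hence cancellable. *)
apply: (mulfI (expf_neq0 r.+1 a0)); rewrite det_scalar_addmulC WU.
apply: (mulfI (expf_neq0 1 b0)); rewrite mulrCA det_scalar_addmulC.
rewrite det_mx11 !mxE.
under eq_bigr do rewrite !mxE mul1r.
rewrite sumr_const card_ord defN -/a -/b exprD.
have -> : 'X - (d + (r * q.+1)%:R)%:P = b + - q.+1%:R *+ r.+1.
  rewrite /b polyCB polyCD !polyC_natr; ring.
by rewrite mulr1n [b ^+ r.+1]exprS; ring.
Qed.

(** * Degrees, spectrum and energy of multipartite graphs *)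

(** The degrees count ordered adjacent pairs, and an edge arises from exactly two of these, distinct
    because adjacency is irreflexive. *)
Lemma handshake (g : sgraph) : (2 * #|edges g| = \sum_(x : g) degree x)%N.
Proof.
have -> : (\sum_(x : g) degree x = \sum_(p : g * g | adj p.1 p.2) 1)%N.
  rewrite -(pair_big_dep predT (@adj g) (fun _ _ => 1%N)) /=.
  by apply: eq_bigr => x _; rewrite sum1_card /degree cardsE.
transitivity (\sum_(p in [set p : g * g | adj p.1 p.2]) 1)%N; last first.
  by apply: eq_bigl => p; rewrite inE.
rewrite (partition_big_imset (fun p : g * g => [set p.1; p.2])) /= -/(edges g).
rewrite mulnC -sum_nat_const; apply: eq_bigr => _ /imsetP[[x y] + ->] /=.
rewrite inE /= => adj_xy.
have neq_xy : x != y by apply: contraTneq adj_xy => ->; rewrite adj_irrefl.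
have -> : 2%N = #|[set (x, y); (y, x)]|.
  by rewrite cards2 xpair_eqE negb_and neq_xy.
rewrite -sum1_card; apply: eq_bigl => -[u v]; rewrite !inE /= !xpair_eqE.
apply/idP/idP=> [/orP[]/andP[/eqP-> /eqP->]|/andP[adj_uv /eqP defE]].
- by rewrite adj_xy eqxx.
- by rewrite adj_sym adj_xy setUC eqxx.
have neq_uv : u != v by apply: contraTneq adj_uv => ->; rewrite adj_irrefl.
have := set21 u v; have := set22 u v; rewrite defE !inE.
by case/pred2P=> ev /pred2P[] eu; move: neq_uv; rewrite eu ev ?eqxx ?orbT.
Qed.

Lemma mean_degree_regular (C : numClosedFieldType) (g : sgraph) d :
  (forall x : g, degree x = d) -> (0 < #|g|)%N ->
  (2 * #|edges g|)%:R / #|g|%:R = d%:R :> C.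
Proof.
move=> hd g_gt0; rewrite handshake (eq_bigr (fun=> d)) // sum_nat_const.
by rewrite natrM mulrAC divff ?mul1r // pnatr_eq0 -lt0n.
Qed.

(** The neighbours of [x] are exactly the vertices outside its own fibre. *)
Lemma multipartite_degree (g : sgraph) (K : finType) (f : g -> K) (q : nat) :
    (forall x y, adj x y = (f x != f y)) ->
    (forall k, #|[set x | f x == k]| = q) ->
  forall x : g, degree x = (#|K|.-1 * q)%N.
Proof.
move=> fE fq x; rewrite -subn1 mulnBl mul1n -(card_uniform_fibers _ _ _ _ fq).
rewrite -[in RHS](fq (f x)) -cardsT -cardsDS ?subsetT // /degree.
by apply: eq_card => y; rewrite !inE fE eq_sym andbT.
Qed.

Lemma signless_spectrum_multipartite (C : numClosedFieldType) (g : sgraph)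
    (K : finType) (f : g -> K) (r q : nat) :
    (forall x y, adj x y = (f x != f y)) ->
    (forall k, #|[set x | f x == k]| = q.+1) -> #|K| = r.+1 ->
  perm_eq (signless_spectrum C g)
    (nseq (r.+1 * q) (r * q.+1)%:R ++ nseq r ((r * q.+1)%:R - q.+1%:R)
      ++ nseq 1 ((r * q.+1)%:R *+ 2)).
Proof.
(* Two lists of roots agree up to order once their products of linear factors agree, so
   characteristic polynomials are compared. *)
move=> fE fq cardK; apply: prod_XsubC_eq; rewrite -spectrumP.
have degE := multipartite_degree _ _ _ _ fE fq.
(* [h] is [f] read through the enumerations of vertices and parts, as the matrix is indexed by
   ordinals. *)
pose h (i : 'I_#|g|) := cast_ord cardK (enum_rank (f (enum_val i))).
have hq k : #|[set i | h i == k]| = q.+1.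
  rewrite -(fq (enum_val (cast_ord (esym cardK) k))).
  rewrite -[RHS](card_imset _ enum_rank_inj); apply: eq_card => i.
  rewrite -{2}[i]enum_valK mem_imset ?inE; last exact: enum_rank_inj.
  rewrite /h -(inj_eq (@cast_ord_inj _ _ (esym cardK))) cast_ordK.
  by rewrite -(inj_eq enum_val_inj) enum_rankK.
have hE i j : (h i != h j) = adj (enum_val i : g) (enum_val j).
  by rewrite fE /h (inj_eq (@cast_ord_inj _ _ _)) (inj_eq enum_rank_inj).
have -> : signless_laplacian C g = \matrix_(i, j)
    ((r * q.+1)%:R *+ (i == j) + (h i != h j)%:R).
  by apply/matrixP => i j; rewrite !mxE degE cardK hE.
rewrite (char_poly_multipartite _ _ _ _ _ _ hq) !big_cat !big_nseq /= mulr1.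
by rewrite -!iter_mulr_1 mulrA [_ *+ 2]mulr2n.
Qed.

(** With [d = r * q.+1] the common degree, the eigenvalues [d], [d - q.+1] and [2d] deviate from the
    mean degree by 0, [q.+1] ([r] times) and [d] (once), which add up to [2d]. *)
Lemma signless_energy_multipartite (C : numClosedFieldType) (g : sgraph)
    (K : finType) (f : g -> K) (r q : nat) :
    (forall x y, adj x y = (f x != f y)) ->
    (forall k, #|[set x | f x == k]| = q.+1) -> #|K| = r.+1 ->
  signless_energy C g = (r * q.+1)%:R *+ 2.
Proof.
move=> fE fq cardK; rewrite /signless_energy.
rewrite (@mean_degree_regular C g (r * q.+1)).
- rewrite (perm_big _ (signless_spectrum_multipartite C _ _ _ _ _ fE fq cardK)).
  rewrite !big_cat !big_nseq /= !iter_addr_0 subrr normr0 mul0rn add0r addr0.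
  rewrite addrAC subrr add0r normrN normr_nat [_ *+ 2]mulr2n addrK.
  by rewrite normr_nat natrM mulr_natl.
- by move=> x; rewrite (multipartite_degree _ _ _ _ fE fq) cardK.
by rewrite (card_uniform_fibers _ _ _ _ fq) cardK.
Qed.

(** * Commutation in the Hanaki group and its non-commuting graph *)

Lemma hanaki_elt_inj (F : finFieldType) (V : {rmorphism F -> F}) a b a' b' :
  hanaki_elt V a b = hanaki_elt V a' b' -> a = a' /\ b = b'.
Proof.
move=> /(congr1 val)/matrixP eqM.
by split; [have := eqM 1 0 | have := eqM ord_max 0]; rewrite !mxE.
Qed.

Lemma card_hanaki_fiber (F : finFieldType) (V : {rmorphism F -> F}) a :
  #|[set hanaki_elt V a b | b in [set: F]]| = #|F|.
Proof.
by rewrite card_imset ?cardsT // => b b' /hanaki_elt_inj[].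
Qed.

Lemma hanaki_frobenius_comm (F : finFieldType) (char2 : 2 \in [pchar F])
    (V := pFrobenius_aut char2) a b a' b' :
  (hanaki_elt V a b * hanaki_elt V a' b' ==
     hanaki_elt V a' b' * hanaki_elt V a b)%g = [|| a == 0, a' == 0 | a == a'].
Proof.
rewrite !hanaki_eltM /V /= !pFrobenius_autE.
have -> : [|| a == 0, a' == 0 | a == a'] = (a' * a ^+ 2 == a * a' ^+ 2).
  rewrite -(subr_eq0 (a' * _)) -[_ == a']subr_eq0 -!mulf_eq0.
  by apply: (congr1 (eq_op^~ 0)); ring.
rewrite [a' + a]addrC [b' + b]addrC.
by apply/eqP/eqP => [/hanaki_elt_inj[_ /addrI]|->].
Qed.

Lemma hanaki_frobenius_multipartite (F : finFieldType)
    (char2 : 2 \in [pchar F]) (F_gt2 : (2 < #|F|)%N)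
    (gT : finGroupType) (G : {group gT}) :
    G \isog hanaki (pFrobenius_aut char2) ->
  exists f : noncommuting_graph G -> {a : F | a != 0},
    (forall x y, adj x y = (f x != f y)) /\
    (forall k, #|[set x | f x == k]| = #|F|).
Proof.
set V := pFrobenius_aut char2 => /isogP[/= phi phi_inj phiG].
(* [c x] is the parameter [a] of the matrix U(a,b) corresponding to [x]; it labels the part of
   [x]. *)
pose c (x : gT) : F := val (phi x) 1 0.
have phiE x : x \in G -> exists b, phi x = hanaki_elt V (c x) b.
  move=> Gx; have: phi x \in hanaki V by rewrite -phiG mem_morphim.
  case/imsetP=> -[a b] _ /= def_phi; exists b; rewrite def_phi /c def_phi.
  by rewrite mxE.
have phi_onto a b : exists2 x, x \in G & phi x = hanaki_elt V a b.
  have: hanaki_elt V a b \in phi @* G.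
    by rewrite phiG; apply/imsetP; exists (a, b).
  by case/morphimP=> x Gx _ ->; exists x.
have commE x y : x \in G -> y \in G ->
    (x * y == y * x)%g = [|| c x == 0, c y == 0 | c x == c y].
  move=> Gx Gy; rewrite -(inj_in_eq (injmP phi_inj)) ?groupM // !morphM //.
  have [b ->] := phiE x Gx; have [b' ->] := phiE y Gy.
  exact: hanaki_frobenius_comm.
have noncentralE x : (x \in G :\: 'Z(G)) = (x \in G) && (c x != 0).
  rewrite inE andbC; apply: andb_id2l => Gx; congr (~~ _).
  rewrite inE Gx /=; apply/centP/eqP => [cGx | c0 y Gy]; last first.
    by apply/eqP; rewrite commE // c0 eqxx.
  apply/eqP/negPn/negP => cx0.
  (* As [F] has more than two elements, some [a] differs from both 0 and [c x]; then U(a,0) does not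
     commute with the image of [x], so [x] is not central. *)
  have /subsetPn[a _] : ~~ ([set: F] \subset [set 0; c x]).
    apply: contraL F_gt2 => /subset_leq_card; rewrite cardsT cards2 -leqNgt.
    by move=> /leq_trans->//; case: (_ == _).
  rewrite !inE negb_or => /andP[a0 acx].
  have [y Gy phiy] := phi_onto a 0.
  have cy : c y = a by rewrite /c phiy mxE.
  have := cGx y Gy => /eqP; rewrite commE // cy (negPf cx0) (negPf a0) eq_sym.
  by rewrite (negPf acx).
have c0 (x : noncentral G) : c (val x) != 0.
  by have := valP x; rewrite noncentralE => /andP[].
have Gval (x : noncentral G) : val x \in G.
  by have := valP x; rewrite noncentralE => /andP[].
exists (fun x => Sub (c (val x)) (c0 x)); split=> [x y | k].
  rewrite /adj /= /noncommuting commE // (negPf (c0 x)) (negPf (c0 y)) /=.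
  by rewrite -val_eqE.
(* [phi] maps the fibre over [k] bijectively onto the matrices U(k,b), with [b] ranging over [F]. *)
rewrite -(card_hanaki_fiber _ V (val k)).
have phi_val_inj : injective (fun x : noncentral G => phi (val x)).
  by move=> x y /(injmP phi_inj)-/(_ (Gval x) (Gval y))/val_inj.
rewrite -(card_imset _ phi_val_inj); apply: eq_card => A.
apply/imsetP/imsetP => [[x] | [b _ ->]].
  rewrite inE -val_eqE /= => /eqP <- ->.
  by have [b ->] := phiE _ (Gval x); exists b.
have [x Gx phix] := phi_onto (val k) b.
have cx : c x = val k by rewrite /c phix mxE.
have ncx : x \in G :\: 'Z(G) by rewrite noncentralE Gx cx (valP k).
by exists (Sub x ncx); rewrite // inE -val_eqE /= cx.
Qed.

Theorem theorem5p2 (C : numClosedFieldType) (n : nat) (hn : (2 <= n)%N)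
    (F : finFieldType) (hF : #|F| = (2 ^ n)%N)
    (gT : finGroupType) (G : {group gT})
    (hG : G \isog hanaki (pFrobenius_aut (card_finPcharP hF isT))) :
  perm_eq (signless_spectrum C (noncommuting_graph G))
    (nseq (2 ^ (2 * n) - 2 ^ (n + 1) + 1)%N (2 ^+ (2 * n) - 2 ^+ (n + 1))
     ++ nseq (2 ^ n - 2)%N (2 ^+ (2 * n) - 3 * 2 ^+ n)
     ++ nseq 1 (2 ^+ (2 * n + 1) - 2 ^+ (n + 2)))
  /\ signless_energy C (noncommuting_graph G)
     = 2 ^+ (2 * n + 1) - 2 ^+ (n + 2).
Proof.
have F_ge4 : (4 <= #|F|)%N by rewrite hF (leq_pexp2l (isT : 0 < 2)%N hn).
have [f [fE fq]] := hanaki_frobenius_multipartite _ _ (ltnW F_ge4) _ _ hG.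
(* Parts have [q.+1 = 2 ^ n] elements, and there are [r.+1 = 2 ^ n - 1] of them, one per nonzero
   field element. *)
pose q := (2 ^ n - 1)%N; pose r := (2 ^ n - 2)%N.
have defq : q.+1 = (2 ^ n)%N by rewrite /q; lia.
have cardK : #|{: {a : F | a != 0}}| = r.+1.
  by rewrite card_sig (cardC1 0) hF /r; lia.
have fq' k : #|[set x | f x == k]| = q.+1 by rewrite fq hF.
have natr2 : (2 ^ n)%:R = 2 ^+ n :> C by rewrite natrX.
have degE : (r * q.+1)%:R = 2 ^+ (2 * n) - 2 ^+ (n + 1) :> C.
  rewrite defq natrM /r natrB; last lia.
  by rewrite natr2 mul2n -addnn !exprD; ring.
have -> : 2 ^+ (2 * n + 1) - 2 ^+ (n + 2) = (r * q.+1)%:R *+ 2 :> C.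
  by rewrite degE !exprD; ring.
split; last exact: signless_energy_multipartite fE fq' cardK.
have := signless_spectrum_multipartite C _ _ _ _ _ fE fq' cardK.
(* The remaining goals are the first multiplicity, [r.+1 * q], which is the square of [2 ^ n - 1],
   and the second eigenvalue. *)
congr (perm_eq _ (nseq _ _ ++ nseq _ _ ++ _)) => //.
  by rewrite mul2n -addnn !expnD /q /r; nia.
by rewrite degE defq natr2 exprD; ring.
Qed.
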